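(* Let $d\ge3$ be an odd integer. Then for every $\varepsilon>0$ there exists a constant $C$ (independent of $N$) such that for all positive integers $N$, $$K_{d,6,N}\le C N^{\varepsilon}.$$
   Context: Here $\mathbb T=\mathbb R/\mathbb Z$, and $K_{d,p,N}$ denotes the best (smallest) constant such that for all complex numbers $a_{-N},\dots,a_N$, $$\Big\|\sum_{n=-N}^N a_n e^{2\pi i t n^d+2\pi i x n}\Big\|_{L^p_{x,t}(\mathbb T\times\mathbb T)}\le K_{d,p,N}\Big(\sum_{n=-N}^N|a_n|^2\Big)^{1/2}.$$ *)

(* Defs.v *)
From mathcomp Require Import all_boot all_order all_algebra.
From mathcomp Require Import all_classical all_reals all_analysis.
From mathcomp Require Import complex.

Set Implicit Arguments.
Unset Strict Implicit.
Unset Printing Implicit Defensive.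

Import Order.TTheory GRing.Theory Num.Theory.

Local Open Scope ring_scope.
Local Open Scope complex_scope.

(* The Haar probability measure of T = R/Z, carried by the fundamental domain
   [0, 1] (the endpoints are negligible). *)
Definition haarT (R : realType) : probability (measurableTypeR R) R :=
  uniform_prob (@ltr01 R).

Definition haarTT (R : realType) :
    probability (measurableTypeR R * measurableTypeR R)%type R :=
  (haarT R \x haarT R)%E.

(* e(u) = exp (2 pi i u) *)
Definition e2pi (R : realType) (u : R) : R[i] :=
  cos (2 * pi * u) +i* sin (2 * pi * u).

Definition cmod (R : realType) (z : R[i]) : R := complex.Re `|z|.

(* As k ranges over 'I_(2N+1), freq k ranges over -N, ..., N. *)
Definition freq (N : nat) (k : 'I_N.*2.+1) : int := k%:Z - N%:Z.

(* The space-time variable is z = (x, t). Only the values of a on [-N, N]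
   matter. *)
Definition expsum (R : realType) (d N : nat) (a : int -> R[i])
    (z : R * R) : R[i] :=
  \sum_(k < N.*2.+1)
     a (freq k) * e2pi (z.2 * (freq k ^+ d)%:~R + z.1 * (freq k)%:~R).

Definition l2norm (R : realType) (N : nat) (a : int -> R[i]) : R :=
  Num.sqrt (\sum_(k < N.*2.+1) cmod (a (freq k)) ^+ 2).

Definition admissible (R : realType) (d : nat) (p : \bar R) (N : nat)
    (K : R) : Prop :=
  forall a : int -> R[i],
    (Lnorm (haarTT R) p (fun z => (cmod (expsum d N a z))%:E)
     <= (K * l2norm N a)%:E)%E.

(* K_{d,p,N}: taken in \bar R so that an empty set of admissible constants
   would give +oo, not a default real value. *)
Definition best_const (R : realType) (d : nat) (p : \bar R) (N : nat) :
    \bar R :=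
  ereal_inf [set K%:E | K in [set K : R | admissible d p N K]]%classic.

(* Main.v *)
(* Write |F|^6 = |F^3|^2, where F^3 is a trigonometric polynomial indexed by
   triples u = (u1, u2, u3) of frequencies. By orthogonality its L^2 norm is at
   most the sum of |A_u| |A_v| over pairs with u1 + u2 + u3 = v1 + v2 + v3 =: l
   and u1^d + u2^d + u3^d = v1^d + v2^d + v3^d =: m. As d is odd, v1 + v2 and
   v2 + v3 divide D := l^d - m. If D <> 0, the divisor bound leaves O(N^eps)
   triples v for each u, and Cauchy-Schwarz applies. If D = 0, two entries of
   each triple cancel by strict convexity, the third one is l, and the
   contribution is at most 9 ||a||_2^6. *)
Require Import Defs.
From mathcomp Require Import all_boot all_order all_algebra.
From mathcomp Require Import all_classical all_reals all_analysis.
From mathcomp Require Import measurable_realfun complex.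
From mathcomp Require Import zify ring lra.

Set Implicit Arguments.
Unset Strict Implicit.
Unset Printing Implicit Defensive.

Import Order.TTheory GRing.Theory Num.Theory.
Import numFieldNormedType.Exports.

Local Open Scope ring_scope.

(** * The divisor bound *)

(** [divisors] folds over the prime decomposition; a factor [(p, e)] merges in one more list of the
    previous length [e] times. Merging adds lengths, so each factor multiplies the size by
    [e + 1]. *)
Lemma size_divisors (n : nat) :
  size (divisors n) = (\prod_(f <- prime_decomp n) f.2.+1)%N.
Proof.
rewrite /divisors; elim: (prime_decomp n) => [|[p e] s IHs] /=.
  by rewrite big_nil.
rewrite big_cons -IHs /=; set ds := foldr _ _ _.
elim: e => [|e IHe]; first by rewrite mul1n.
by rewrite iterS size_merge size_cat size_map IHe addnC mulSn.
Qed.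

(** With q the integer quotient of e by k, e + 1 <= k (q + 1), q + 1 <= 2^q, and 2^(q k) <= 2^e. *)
Lemma leq_expSn_exp2 (k e : nat) : (0 < k)%N -> (e.+1 ^ k <= k ^ k * 2 ^ e)%N.
Proof.
move=> k_gt0; apply: (@leq_trans ((k * (e %/ k).+1) ^ k)).
  by rewrite leq_exp2r// mulnC mulSn addnC {1}(divn_eq e k) -addnS leq_add2l ltn_mod.
rewrite expnMn leq_mul2l; apply/orP; right.
apply: (@leq_trans ((2 ^ (e %/ k)) ^ k)); first by rewrite leq_exp2r// ltn_expl.
by rewrite -expnM leq_exp2l// leq_trunc_div.
Qed.

(* For p >= 2^k the factor (e+1)^k is at most p^e; each of the fewer than 2^k
   smaller primes costs an extra k^k. *)
Lemma size_divisors_exp (k n : nat) : (0 < k)%N -> (0 < n)%N ->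
  (size (divisors n) ^ k <= (k ^ k) ^ (2 ^ k) * n)%N.
Proof.
move=> k_gt0 n_gt0; set c := (k ^ k)%N.
have c_gt0 : (0 < c)%N by rewrite expn_gt0 k_gt0.
have nE := prod_prime_decomp n_gt0.
rewrite size_divisors.
rewrite (big_morph _ (fun a b => expnMn a b k) (exp1n k)).
apply: (@leq_trans (\prod_(f <- prime_decomp n)
    ((if (f.1 < 2 ^ k)%N then c else 1) * f.1 ^ f.2))%N).
  rewrite !big_seq; apply: leq_prod => -[p e] pe.
  have [/prime_gt1 p_gt1 _ _] := mem_prime_decomp pe => /=.
  case: ifPn => [_|]; last rewrite -leqNgt => le_p.
    apply: leq_trans (leq_expSn_exp2 e k_gt0) _.
    by rewrite leq_mul2l; apply/orP; right; case: e {pe} => // e; rewrite leq_exp2r.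
  rewrite mul1n; apply: (@leq_trans ((2 ^ e) ^ k)).
    by rewrite leq_exp2r// ltn_expl.
  rewrite -expnM mulnC expnM; case: e {pe} => // e.
  by rewrite leq_exp2r.
rewrite big_split/= -nE leq_mul2r; apply/orP; right.
have -> : (\prod_(f <- prime_decomp n) (if f.1 < 2 ^ k then c else 1) =
           c ^ count (fun f => f.1 < 2 ^ k) (prime_decomp n))%N.
  by rewrite -big_mkcond/= big_const_seq iter_muln_1.
apply: leq_pexp2l => //.
have -> : (count (fun f : nat * nat => f.1 < 2 ^ k) (prime_decomp n) =
           count (fun p => p < 2 ^ k) (primes n))%N by rewrite /primes /unzip1 count_map.
rewrite -size_filter -[leqRHS](size_iota 0).
apply: uniq_leq_size; first by rewrite filter_uniq// primes_uniq.
by move=> p; rewrite mem_filter mem_iota => /andP[].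
Qed.

(** * Sums of odd powers of integers *)

(* Sum and difference go together: passing from n to n + 1 maps (S, D) to
   (s S + h D, s D + h S). *)
Lemma expr_sumdiff_lt (R : realDomainType) (s h h' : R) (n : nat) :
  0 < s -> 0 <= h' -> h' < h ->
  [/\ (s + h') ^+ n.+2 + (s - h') ^+ n.+2 < (s + h) ^+ n.+2 + (s - h) ^+ n.+2,
      0 <= (s + h') ^+ n.+2 + (s - h') ^+ n.+2,
      (s + h') ^+ n.+2 - (s - h') ^+ n.+2 < (s + h) ^+ n.+2 - (s - h) ^+ n.+2 &
      0 <= (s + h') ^+ n.+2 - (s - h') ^+ n.+2].
Proof.
move=> s_gt0 h'_ge0 lt_h; elim: n => [|n].
  by rewrite !expr2; split; nra.
rewrite !(exprS _ n.+2); move: (_ ^+ _) (_ ^+ _) (_ ^+ _) (_ ^+ _).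
by move=> a b c e [? ? ? ?]; split; nra.
Qed.

(* For fixed x + y > 0, x^d + y^d is strictly increasing in |x - y|. *)
Lemma sum_expr_inj (d : nat) (x y p q : int) : (1 < d)%N ->
  0 < x + y -> x + y = p + q -> x ^+ d + y ^+ d = p ^+ d + q ^+ d ->
  x = p \/ x = q.
Proof.
case: d => [|[|d]]// _ s_gt0 exy.
(* Doubling avoids halves: 2u and 2v are the sum plus or minus the difference, and taking the
   absolute value only swaps the two terms. *)
have dbl (u v : int) : (u + v + `|u - v|) ^+ d.+2 + (u + v - `|u - v|) ^+ d.+2 =
    2 ^+ d.+2 * (u ^+ d.+2 + v ^+ d.+2).
  rewrite mulrDr -!exprMn; have [le_uv|/ltW le_uv] := leP 0 (u - v).
    by congr (_ ^+ _ + _ ^+ _); lia.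
  by rewrite [LHS]addrC; congr (_ ^+ _ + _ ^+ _); lia.
move=> /(congr1 ( *%R (2 ^+ d.+2))); rewrite -!dbl exy => e.
suff : `|x - y| = `|p - q| by lia.
case: (ltgtP `|x - y| `|p - q|) => // lt_xy.
  have := expr_sumdiff_lt d s_gt0 (normr_ge0 _) lt_xy.
  by rewrite exy e ltxx; case.
have := expr_sumdiff_lt d s_gt0 (normr_ge0 _) lt_xy.
by rewrite exy e ltxx; case.
Qed.

Lemma exprN_odd (R : pzRingType) (d : nat) (x : R) : odd d -> (- x) ^+ d = - x ^+ d.
Proof. by move=> d_odd; rewrite exprNn -signr_odd d_odd expr1 mulN1r. Qed.

(** Moving z^d across as (-z)^d leaves two pairs with the same sum x + y and the same sum of d-th
    powers, so x is either x + y + z or -z. *)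
Lemma sum_expr_odd_eq (d : nat) (x y z : int) : (1 < d)%N -> odd d ->
  x ^+ d + y ^+ d + z ^+ d = (x + y + z) ^+ d ->
  [\/ x + y = 0, y + z = 0 | z + x = 0].
Proof.
move=> d_gt1 d_odd e.
have [xy0|] := eqVneq (x + y) 0; first by constructor 1.
(* Negating all three variables preserves the equation, as [d] is odd. *)
wlog xy_gt0 : x y z e / 0 < x + y => [hwlog xy0|].
  have [xy_gt0|xy_le0] := ltP 0 (x + y); first exact: hwlog.
  case: (hwlog (- x) (- y) (- z)); rewrite -?opprD ?oppr_eq0//.
  - by rewrite !exprN_odd// -!opprD e.
  - by lia.
  - by move=> ?; constructor 1; lia.
  - by move=> ?; constructor 2; lia.
  - by move=> ?; constructor 3; lia.
move=> _; have e' : x ^+ d + y ^+ d = (x + y + z) ^+ d + (- z) ^+ d.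
  by rewrite exprN_odd// -e addrK.
have [] := sum_expr_inj d_gt1 xy_gt0 _ e'; first by rewrite addrK.
  by move=> ?; constructor 2; lia.
by move=> ?; constructor 3; lia.
Qed.

Lemma dvdz_sum_expr_odd (d : nat) (x y : int) : odd d -> (x + y %| x ^+ d + y ^+ d)%Z.
Proof.
move=> d_odd; have := subrXX x (- y) d.
by rewrite opprK exprN_odd// opprK => ->; apply: dvdz_mulr; exact: dvdzz.
Qed.

(** Group the right-hand side as ((x + y + z)^d + (-z)^d) - (x^d + y^d): in both brackets the bases
    add up to x + y. *)
Lemma dvdz_expr_sum3 (d : nat) (x y z : int) : odd d ->
  (x + y %| (x + y + z) ^+ d - (x ^+ d + y ^+ d + z ^+ d))%Z.
Proof.
move=> d_odd.
have -> : (x + y + z) ^+ d - (x ^+ d + y ^+ d + z ^+ d) =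
    ((x + y + z) ^+ d + (- z) ^+ d) - (x ^+ d + y ^+ d).
  by rewrite exprN_odd//; ring.
apply: rpredB; last exact: dvdz_sum_expr_odd.
by have := dvdz_sum_expr_odd (x + y + z) (- z) d_odd; rewrite addrK.
Qed.

(** * Resonant triples *)

(** Every [u] in [P] is hit at least once; repeated values of [g] are harmless because the terms are
    nonnegative. *)
Lemma ler_sum_image (R : numDomainType) (I J : finType) (P : pred J)
    (g : I -> J) (B : J -> R) : (forall u, 0 <= B u) ->
  (forall u, P u -> exists i, u = g i) ->
  \sum_(u | P u) B u <= \sum_i B (g i).
Proof.
move=> B_ge0 Pg; rewrite (partition_big g predT)//= big_mkcond; apply: ler_sum => u _.
case: ifPn => [/Pg[i ->]|_]; last by apply: sumr_ge0.
rewrite (bigD1 i)//= lerDl; exact: sumr_ge0.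
Qed.

(** A Schur test: B u B v <= (B u^2 + B v^2) / 2, and by symmetry of [r] each half is a sum in which
    every index has at most [M] partners. *)
Lemma sum_rel_le (R : realFieldType) (T : finType) (r : rel T) (B : T -> R)
    (M : nat) : symmetric r -> (forall u, #|r u| <= M)%N ->
  \sum_u \sum_(v | r u v) B u * B v <= M%:R * \sum_u B u ^+ 2.
Proof.
move=> rC leM.
have half u : \sum_(v | r u v) B u ^+ 2 / 2 <= M%:R * B u ^+ 2 / 2.
  rewrite -mulr_suml ler_pM2r ?invr_gt0//.
  rewrite sumr_const -[leLHS]mulr_natl ler_wpM2r ?sqr_ge0// ler_nat; exact: leM.
have -> : M%:R * (\sum_u B u ^+ 2) = \sum_u M%:R * B u ^+ 2 by rewrite mulr_sumr.
apply: (@le_trans _ _ (\sum_u \sum_(v | r u v) (B u ^+ 2 / 2 + B v ^+ 2 / 2))).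
  by apply: ler_sum => u _; apply: ler_sum => v _; have := sqr_ge0 (B u - B v); nra.
under eq_bigr do rewrite big_split/=.
rewrite big_split/= [X in _ + X](exchange_big_dep predT)//=.
under [X in _ + X]eq_bigr do under eq_bigl do rewrite rC.
rewrite -big_split/=; apply: ler_sum => u _; have := half u; lra.
Qed.

Section ResonantTriples.
Context (T : finType) (f : T -> int).
Implicit Types u v : T * T * T.

Definition psum (k : nat) u : int := f u.1.1 ^+ k + f u.1.2 ^+ k + f u.2 ^+ k.

Definition resonant (d : nat) u v : bool :=
  (psum 1 u == psum 1 v) && (psum d u == psum d v).

(** The D of the outline. It depends only on the two power sums, so all triples resonant with [u]
    share it. *)
Definition discr (d : nat) u : int := psum 1 u ^+ d - psum d u.

Lemma psum1E u : psum 1 u = f u.1.1 + f u.1.2 + f u.2.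
Proof. by []. Qed.

Lemma resonant_sym d : symmetric (resonant d).
Proof. by move=> u v; rewrite /resonant eq_sym [psum d u == _]eq_sym. Qed.

Lemma resonant_discr d u v : resonant d u v -> discr d u = discr d v.
Proof. by rewrite /discr => /andP[/eqP-> /eqP->]. Qed.

Lemma discr_eq0 d u : (1 < d)%N -> odd d -> discr d u = 0 ->
  [\/ f u.1.1 + f u.1.2 = 0, f u.1.2 + f u.2 = 0 | f u.2 + f u.1.1 = 0].
Proof.
by move=> d_gt1 d_odd /eqP; rewrite subr_eq0 => /eqP e; exact: sum_expr_odd_eq (esym e).
Qed.

Lemma dvdz_discr12 d u : odd d -> (f u.1.1 + f u.1.2 %| discr d u)%Z.
Proof. by move=> d_odd; exact: dvdz_expr_sum3. Qed.

Lemma dvdz_discr23 d u : odd d -> (f u.1.2 + f u.2 %| discr d u)%Z.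
Proof.
move=> d_odd; have := dvdz_expr_sum3 (f u.1.2) (f u.2) (f u.1.1) d_odd.
by rewrite /discr psum1E /psum -!addrA addrC [X in _ - X]addrC -!addrA; apply: etrans;
  congr (_ %| _)%Z; congr (_ ^+ _ - _); ring.
Qed.

Hypothesis f_inj : injective f.

(** The total of a resonant [v] is prescribed, so v1 + v2 and v2 + v3 determine [v]; both divide the
    common discriminant. *)
Lemma card_resonant d u : odd d -> discr d u != 0 ->
  (#|resonant d u| <= (2 * size (divisors `|discr d u|)) ^ 2)%N.
Proof.
move=> d_odd Du0; set ds := divisors _.
(* Divisors of both signs, whence the factor 2. *)
pose zs : seq int := [seq Posz n | n <- ds] ++ [seq - Posz n | n <- ds].
have zsP z : (z %| discr d u)%Z -> z \in zs.
  move=> zD; have : `|z|%N \in ds by rewrite -dvdn_divisors// absz_gt0.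
  move=> zds; rewrite mem_cat; case: (ltP z 0) => z0; apply/orP.
    by right; apply/mapP; exists `|z|%N => //; lia.
  by left; apply/mapP; exists `|z|%N => //; lia.
have size_zs : size zs = (2 * size ds)%N.
  by rewrite size_cat !size_map mul2n addnn.
pose h v := (f v.1.1 + f v.1.2, f v.1.2 + f v.2).
have hinj : {in resonant d u &, injective h}.
  move=> [[a b] c] [[a' b'] c'] /andP[/eqP e1 _] /andP[/eqP e2 _] [].
  rewrite !psum1E/= in e1 e2 * => e3 e4.
  by congr (_, _, _); apply: f_inj; lia.
rewrite cardE -(size_map h) -size_zs -mulnn -(size_allpairs pair zs zs).
apply: uniq_leq_size.
  by rewrite map_inj_in_uniq ?enum_uniq// => v w; rewrite !mem_enum; exact: hinj.
move=> _ /mapP[v + ->]; rewrite mem_enum => /resonant_discr Dv.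
by apply/allpairsP; exists (h v); split=> //=; apply: zsP; rewrite Dv;
  [exact: dvdz_discr12|exact: dvdz_discr23].
Qed.

Context (R : realFieldType) (b : T -> R).
Hypothesis b_ge0 : forall i, 0 <= b i.

Definition weight u : R := b u.1.1 * b u.1.2 * b u.2.

Lemma weight_ge0 u : 0 <= weight u.
Proof. by rewrite !mulr_ge0. Qed.

Lemma sum_weight_sqr : \sum_u weight u ^+ 2 = (\sum_i b i ^+ 2) ^+ 3.
Proof.
rewrite exprSr expr2 big_distrlr/= pair_big/= big_distrlr/= pair_big/=.
by apply: eq_bigr => u _; rewrite /weight !exprMn.
Qed.

(** Negation of frequencies, read on the indices; it will be [rev_ord]. *)
Context (s : T -> T).
Hypothesis f_opp : forall i, f (s i) = - f i.

(** Each of the three families contributes the sum of b i * b (s i) * b l. As [s] is a bijection, b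
    i * b (s i) <= (b i^2 + b (s i)^2) / 2 bounds it by the square sum times b l. Overlaps between
    families only help. *)
Lemma sum_weight_degenerate l :
  \sum_(u | [exists i, [|| u == (i, s i, l), u == (l, i, s i) | u == (s i, l, i)]])
    weight u <= 3 * (\sum_i b i ^+ 2) * b l.
Proof.
pose g (i : T + T + T) := match i with
  | inl (inl i) => (i, s i, l) | inl (inr i) => (l, i, s i) | inr i => (s i, l, i)
  end.
have s_inj : injective s.
  by move=> i j /(congr1 f); rewrite !f_opp => /oppr_inj; exact: f_inj.
have diag : \sum_i b i * b (s i) <= \sum_i b i ^+ 2.
  have e : \sum_i b (s i) ^+ 2 = \sum_i b i ^+ 2.
    by rewrite [RHS](reindex_inj s_inj).
  have : 0 <= \sum_i (b i - b (s i)) ^+ 2 by apply: sumr_ge0 => i _; exact: sqr_ge0.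
  under eq_bigr do rewrite sqrrB.
  by rewrite big_split/= sumrB e sumrMnl; lra.
apply: (@le_trans _ _ (\sum_i weight (g i))).
  apply: ler_sum_image => [u|u /existsP[i /or3P[]/eqP ->]]; first exact: weight_ge0.
  - by exists (inl (inl i)).
  - by exists (inl (inr i)).
  - by exists (inr i).
rewrite !big_sumType/= /weight/=.
rewrite (eq_bigr (fun i => b i * b (s i) * b l))//.
rewrite [X in _ + X + _](eq_bigr (fun i => b i * b (s i) * b l)); last by move=> *; ring.
rewrite [X in _ + X](eq_bigr (fun i => b i * b (s i) * b l)); last by move=> *; ring.
by rewrite -big_distrl/=; have := ler_wpM2r (b_ge0 l) diag; lra.
Qed.

(* A triple with zero discriminant is a permutation of (i, s i, l), and the
   resonance condition forces the same l for u and v: the double sum is a sum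
   over l of squares. *)
Lemma sum_resonant_degenerate d : (1 < d)%N -> odd d ->
  \sum_u \sum_(v | (discr d u == 0) && resonant d u v) weight u * weight v
    <= 9 * (\sum_i b i ^+ 2) ^+ 3.
Proof.
move=> d_gt1 d_odd.
pose h l u := [exists i, [|| u == (i, s i, l), u == (l, i, s i) | u == (s i, l, i)]].
have hP u : discr d u = 0 -> exists2 l, h l u & psum 1 u = f l.
  have f_add0 i j : f i + f j = 0 -> j = s i.
    by move=> e; apply: f_inj; rewrite f_opp; lia.
  case: u => -[i j] k /(discr_eq0 d_gt1 d_odd)/=[] /[dup] e /f_add0 e'.
  - by exists k; [apply/existsP; exists i; rewrite e' eqxx | rewrite psum1E/=; lia].
  - by exists i; [apply/existsP; exists j; rewrite e' eqxx orbT | rewrite psum1E/=; lia].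
  - by exists j; [apply/existsP; exists k; rewrite e' eqxx !orbT | rewrite psum1E/=; lia].
set S := \sum_i b i ^+ 2.
have S_ge0 : 0 <= S by apply: sumr_ge0 => i _; exact: sqr_ge0.
(* Expanding the squares gives all pairs of degenerate triples with a common [l]; each inner sum is
   at most 3 S b l, whence 9 S^3. *)
apply: (@le_trans _ _ (\sum_l (\sum_(u | h l u) weight u) ^+ 2)); last first.
  have -> : 9 * S ^+ 3 = \sum_l (3 * S * b l) ^+ 2.
    under eq_bigr do rewrite exprMn.
    by rewrite -mulr_sumr -/S; ring.
  apply: ler_sum => l _; apply: lerXn2r (sum_weight_degenerate l); rewrite nnegrE.
    by apply: sumr_ge0 => u _; exact: weight_ge0.
  by rewrite !mulr_ge0.
under [leRHS]eq_bigr do rewrite expr2 big_distrlr/=.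
rewrite [leRHS](exchange_big_dep predT)//=; apply: ler_sum => u _.
rewrite [leRHS](exchange_big_dep predT)//= big_mkcond/=; apply: ler_sum => v _.
have ww_ge0 : 0 <= weight u * weight v by rewrite mulr_ge0// weight_ge0.
(* A degenerate resonant pair is counted at least once on the right, at the index [l] shared by [u]
   and [v]. *)
case: ifPn => [/andP[/eqP Du uv]|_]; last by apply: sumr_ge0.
have [l hl ul] := hP u Du.
have [l' hl' vl'] := hP v (etrans (esym (resonant_discr uv)) Du).
have ll' : l' = l by apply: f_inj; rewrite -ul -vl'; case/andP: uv => /eqP->.
rewrite ll' in hl'; rewrite (bigD1 l) ?hl//= lerDl; exact: sumr_ge0.
Qed.

(** Split according to whether the discriminant vanishes: [9] comes from the degenerate pairs,
    [(2 * M) ^ 2] from the count of partners. The nondegenerate relation is symmetric because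
    resonant triples share their discriminant. *)
Lemma sum_resonant_le d (M : nat) : (1 < d)%N -> odd d ->
  (forall u, discr d u != 0 -> size (divisors `|discr d u|) <= M)%N ->
  \sum_u \sum_(v | resonant d u v) weight u * weight v
    <= ((2 * M) ^ 2 + 9)%:R * (\sum_i b i ^+ 2) ^+ 3.
Proof.
move=> d_gt1 d_odd leM.
pose r u v := (discr d u != 0) && resonant d u v.
have rC : symmetric r.
  move=> u v; rewrite /r resonant_sym; case uv : (resonant d v u); rewrite ?andbF//.
  by rewrite (resonant_discr uv).
have card_r u : (#|r u| <= (2 * M) ^ 2)%N.
  have [Du0|Du0] := eqVneq (discr d u) 0.
    by rewrite eq_card0// => v; rewrite /r unfold_in Du0 eqxx.
  apply: (@leq_trans #|resonant d u|).
    by apply: subset_leq_card; apply/fintype.subsetP => v; rewrite !unfold_in => /andP[].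
  by apply: leq_trans (card_resonant d_odd Du0) _; rewrite leq_exp2r// leq_mul2l leM.
rewrite natrD mulrDl addrC; have := sum_rel_le weight rC card_r.
rewrite sum_weight_sqr => /(lerD (sum_resonant_degenerate d_gt1 d_odd)).
apply: le_trans; rewrite -big_split/=; apply: ler_sum => u _.
rewrite big_mkcond/= [X in _ <= X + _]big_mkcond/= [X in _ <= _ + X]big_mkcond/=.
rewrite -big_split/=; apply: ler_sum => v _; rewrite /r.
by case: eqP; case: resonant => /=; rewrite ?addr0 ?add0r.
Qed.

End ResonantTriples.

(** * Orthogonality of characters *)

Lemma integral_probability_cst d (T : measurableType d) (R : realType)
    (P : probability T R) (r : R) : (\int[P]_x r%:E = r%:E)%E.
Proof.
rewrite integral_cst//; transitivity (r%:E * 1)%E; last by rewrite mule1.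
by congr (_ * _)%E; exact: probability_setT.
Qed.

Section Orthogonality.
Context (R : realType).
Implicit Types (c : R) (k l m : int).

Lemma sin_period c k : sin (2 * pi * k%:~R + c) = sin c.
Proof.
have per n (x : R) : sin (x + 2 * pi * n%:R) = sin x.
  by rewrite mulr_natl mulr_natr; exact: (periodicn (@sinD2pi R)).
rewrite addrC; case: k => n; first exact: per.
by rewrite NegzE mulrNz mulrN -[in RHS](subrK (2 * pi * n.+1%:~R) c) per.
Qed.

Lemma continuous_cos_affine (a c : R) : continuous (fun t : R => cos (t * a + c)).
Proof.
move=> t; apply: (@continuous_comp _ _ _ (fun t : R => t * a + c) (@cos R)).
  by apply: cvgD; [apply: cvgM; [exact: cvg_id|exact: cvg_cst]|exact: cvg_cst].
exact: continuous_cos.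
Qed.

(* [integral_uniform] only covers nonnegative integrands, hence the 1. *)
Lemma integral01_onePcos (a c : R) : a != 0 -> sin (a + c) = sin c ->
  (\int[lebesgue_measure]_(t in `[0%R, 1%R]) (1 + cos (t * a + c))%:E = 1)%E.
Proof.
move=> a0 per; pose F t := t + sin (t * a + c) / a.
have dF (t : R) : is_derive t 1 F (1 + cos (t * a + c)).
  rewrite /F; apply: is_derive_eq.
  by rewrite /GRing.scale/= !(mul0r, mulr0, addr0, add0r, mulr1, mul1r); field.
have cF : continuous F.
  by move=> t; apply: differentiable_continuous; apply/derivable1_diffP; case: (dF t).
rewrite (@continuous_FTC2 R _ F) ?ltr01//.
- by rewrite /F mul1r mul0r !add0r per -EFinB addrK.
- apply: continuous_subspaceT => t; apply: cvgD; first exact: cvg_cst.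
  exact: continuous_cos_affine.
- split=> [t _| |]; first by case: (dF t).
  + exact/cvg_at_right_filter/cF.
  + exact/cvg_at_left_filter/cF.
- by move=> t _; rewrite derive1E; case: (dF t).
Qed.

Lemma measurable_cos_affine (a c : R) :
  measurable_fun [set: measurableTypeR R] (fun t : R => cos (t * a + c)).
Proof. apply: continuous_measurable_fun; exact: continuous_cos_affine. Qed.

Lemma bounded_integrable d (T : measurableType d) (P : probability T R) (g : T -> R) (M : R) :
  measurable_fun setT g -> (forall x, `|g x| <= M) -> P.-integrable setT (EFin \o g).
Proof.
move=> mg gM; apply: measurable_bounded_integrable => //.
  by apply: le_lt_trans (probability_le1 P measurableT) _; exact: ltry.
by exists M; split; [exact: num_real|move=> y My x _; exact: le_trans (gM x) (ltW My)].
Qed.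

Lemma integral_haarT_cos k c :
  (\int[haarT R]_t (cos (t * (2 * pi * k%:~R) + c))%:E =
   if (k == 0)%R then (cos c)%:E else 0)%E.
Proof.
have [->|k0] := eqVneq k 0.
  under eq_integral do rewrite mulr0 mulr0 add0r.
  exact: integral_probability_cst.
set a := 2 * pi * k%:~R; have a0 : a != 0.
  by rewrite !mulf_neq0 ?intr_eq0// gt_eqF// pi_gt0.
have ic : (haarT R).-integrable setT (EFin \o (fun t => cos (t * a + c))).
  by apply: (@bounded_integrable _ _ _ _ 1) => [|t];
    [exact: measurable_cos_affine|exact: cos_max].
have : (\int[haarT R]_t (1 + cos (t * a + c))%:E = 1)%E.
  rewrite integral_uniform; first by rewrite subr0 invr1 mul1e integral01_onePcos// sin_period.
    by apply/measurable_EFinP; apply: measurable_funD => //; exact: measurable_cos_affine.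
  by move=> t; rewrite lee_fin; have := cos_geN1 (t * a + c); lra.
under eq_integral do rewrite EFinD.
rewrite integralD//; last by apply: (@bounded_integrable _ _ _ (cst 1) 1) => // t; rewrite normr1.
rewrite integral_probability_cst => e.
(* Finiteness of the cosine integral allows cancelling 1 in the extended reals. *)
have := integrable_fin_num measurableT ic.
move: e; case: (integral _ _ _) => //= r [] r0 _; congr EFin.
by apply: (addrI 1); rewrite r0 addr0.
Qed.

(** By Fubini, the inner integral in t absorbs the x-term into the phase; this is why the
    one-variable formula has an arbitrary [c]. *)
Lemma integral_haarTT_cos l m c :
  (\int[haarTT R]_z (cos (2 * pi * (z.2 * m%:~R + z.1 * l%:~R) + c))%:E =
   if ((l == 0) && (m == 0))%R then (cos c)%:E else 0)%E.
Proof.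
pose g (z : R * R) := cos (2 * pi * (z.2 * m%:~R + z.1 * l%:~R) + c).
have mg : measurable_fun [set: measurableTypeR R * measurableTypeR R] g.
  apply: (measurableT_comp (f := cos)).
    by apply: continuous_measurable_fun; exact: continuous_cos.
  apply: measurable_funD => //; apply: measurable_funM => //.
  by apply: measurable_funD; apply: measurable_funM => //.
rewrite -[LHS](@integral12_prod_meas1 _ _ _ _ _ (haarT R) (haarT R) (EFin \o g)); last first.
  by apply: (@bounded_integrable _ _ (haarT R \x haarT R)%E _ 1) => // z; exact: cos_max.
rewrite /fubini_F.
have e (x : R) : (\int[haarT R]_y (EFin \o g) (x, y) =
    if (m == 0)%R then (cos (x * (2 * pi * l%:~R) + c))%:E else 0)%E.
  rewrite -integral_haarT_cos; apply: eq_integral => y _; congr (cos _)%:E => /=.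
  by ring.
under eq_integral do rewrite e.
case: (m == 0); first by rewrite integral_haarT_cos; case: (l == 0).
by rewrite integral0; case: (l == 0).
Qed.

End Orthogonality.

(** * Complex moduli and characters *)

Section Cmod.
Context (R : realType).
Implicit Types (x y z : R[i]) (u v : R).

Lemma cmod_ge0 z : 0 <= cmod z.
Proof. by case: z => a b; exact: sqrtr_ge0. Qed.

Lemma cmodM x y : cmod (x * y) = cmod x * cmod y.
Proof. by have := ComplexField.Normc.normcM x y; case: x => ? ?; case: y. Qed.

Lemma cmodX z n : cmod (z ^+ n) = cmod z ^+ n.
Proof.
elim: n => [|n IHn]; last by rewrite !exprS cmodM IHn.
by rewrite !expr0 /cmod/= expr1n expr0n addr0 sqrtr1.
Qed.

Lemma cmod_conjc z : cmod z^*%C = cmod z.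
Proof. by case: z => a b; rewrite /cmod/= sqrrN. Qed.

Lemma conjcM x y : (x * y)^*%C = x^*%C * y^*%C.
Proof. exact: rmorphM. Qed.

Lemma cmod_sqr z : cmod z ^+ 2 = complex.Re (z * z^*%C).
Proof.
by case: z => a b; rewrite /cmod/= sqr_sqrtr ?addr_ge0 ?sqr_ge0// mulrN opprK -!expr2.
Qed.

Lemma Re_le_cmod z : complex.Re z <= cmod z.
Proof.
case: z => a b; rewrite /cmod/= (le_trans (ler_norm a))// -sqrtr_sqr ler_wsqrtr//.
by rewrite lerDl sqr_ge0.
Qed.

Lemma Re_sum (I : finType) (F : I -> R[i]) :
  complex.Re (\sum_i F i) = \sum_i complex.Re (F i).
Proof. by apply: big_morph => // -[? ?] [? ?]. Qed.

Lemma e2piD u v : e2pi (u + v) = e2pi u * e2pi v.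
Proof. by rewrite /e2pi !mulrDr cosD sinD; congr (_ +i* _)%C; rewrite addrC. Qed.

Lemma e2piN u : e2pi (- u) = (e2pi u)^*%C.
Proof. by rewrite /e2pi !mulrN cosN sinN. Qed.

(* The phase shift keeps cosines only, for [integral_haarTT_cos]. *)
Lemma Re_mul_e2pi z u : complex.Re (z * e2pi u) =
  complex.Re z * cos (2 * pi * u) + complex.Im z * cos (2 * pi * u + pi / 2).
Proof. by case: z => a b /=; rewrite cosDpihalf mulrN. Qed.

End Cmod.

(** * Mean squares of trigonometric polynomials *)

Section L2.
Context (R : realType) (T : finType) (A : T -> R[i]) (l m : T -> int).

(** Several indices may carry the same frequency pair, as happens for triples; the diagonal of
    Parseval becomes a relation on indices. *)
Definition trigpoly (z : R * R) : R[i] :=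
  \sum_u A u * e2pi (z.2 * (m u)%:~R + z.1 * (l u)%:~R).

Lemma cmod_trigpoly_sqr (z : R * R) : cmod (trigpoly z) ^+ 2 =
  \sum_(p : T * T) complex.Re (A p.1 * (A p.2)^*%C *
    e2pi (z.2 * (m p.1 - m p.2)%:~R + z.1 * (l p.1 - l p.2)%:~R)).
Proof.
rewrite cmod_sqr /trigpoly rmorph_sum big_distrlr/= pair_big/= Re_sum.
apply: eq_bigr => p _; congr complex.Re; rewrite conjcM -e2piN mulrACA -e2piD.
by congr (_ * e2pi _); rewrite !rmorphB/=; ring.
Qed.

Lemma integrable_cos_phase (j k : int) (c r : R) :
  (haarTT R).-integrable setT
    (fun z => (r * cos (2 * pi * (z.2 * j%:~R + z.1 * k%:~R) + c))%:E).
Proof.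
apply: (@bounded_integrable _ _ _ (haarTT R) _ `|r|) => [|z].
  apply: measurable_funM => //; apply: (measurableT_comp (f := cos)).
    by apply: continuous_measurable_fun; exact: continuous_cos.
  apply: measurable_funD => //; apply: measurable_funM => //.
  by apply: measurable_funD; apply: measurable_funM => //.
by rewrite normrM ler_piMr// cos_max.
Qed.

Lemma integrable_Re_e2pi (j k : int) (w : R[i]) :
  (haarTT R).-integrable setT
    (fun z => (complex.Re (w * e2pi (z.2 * j%:~R + z.1 * k%:~R)))%:E).
Proof.
(* The added 0 gives the first cosine an explicit phase, as the second one has pi / 2. *)
under eq_fun do rewrite Re_mul_e2pi EFinD -[2 * pi * _ in X in (X + _)%E]addr0.
by apply: integrableD => //; exact: integrable_cos_phase.
Qed.

Lemma integral_Re_e2pi (j k : int) (w : R[i]) :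
  (\int[haarTT R]_z (complex.Re (w * e2pi (z.2 * j%:~R + z.1 * k%:~R)))%:E =
   if ((k == 0) && (j == 0))%R then (complex.Re w)%:E else 0)%E.
Proof.
have ic c : (haarTT R).-integrable setT
    (fun z => (cos (2 * pi * (z.2 * j%:~R + z.1 * k%:~R) + c))%:E).
  by under eq_fun do rewrite -[cos _]mul1r; exact: integrable_cos_phase.
under eq_integral do rewrite Re_mul_e2pi EFinD -[2 * pi * _ in X in (X + _)%E]addr0 !EFinM.
rewrite integralD//; [|exact: integrableZl..].
rewrite !integralZl// !integral_haarTT_cos cos0 cos_pihalf.
by case: ifP => _; rewrite ?mule0 ?mule1 adde0.
Qed.

(** Orthogonality kills every pair with distinct frequencies; the real parts of the remaining
    products are bounded by their moduli. *)
Lemma integral_cmod_trigpoly_sqr :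
  (\int[haarTT R]_z (cmod (trigpoly z) ^+ 2)%:E <=
   (\sum_u \sum_(v | (l u == l v) && (m u == m v)) cmod (A u) * cmod (A v))%:E)%E.
Proof.
under eq_integral do rewrite cmod_trigpoly_sqr -sumEFin.
rewrite integral_sum//=; last by move=> p; exact: integrable_Re_e2pi.
under eq_bigr do rewrite integral_Re_e2pi !subr_eq0.
under [in leRHS]eq_bigr do rewrite big_mkcond.
rewrite pair_big/= -sumEFin; apply: lee_sum => p _.
case: ifP => // _; rewrite lee_fin (le_trans (Re_le_cmod _))//.
by rewrite cmodM cmod_conjc.
Qed.

End L2.

(** * The exponential sum *)

Section ExponentialSum.
Context (R : realType) (d N : nat).
Implicit Types a : int -> R[i].

Local Notation I := 'I_N.*2.+1.

Lemma freq_inj : injective (@freq N).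
Proof. by move=> i j; rewrite /freq => /addIr[] /val_inj. Qed.

Lemma freq_rev (i : I) : freq (rev_ord i) = - freq i.
Proof. by rewrite /freq/=; have := ltn_ord i; lia. Qed.

Lemma normz_freq (i : I) : `|freq i| <= N%:Z.
Proof. by rewrite /freq; have := ltn_ord i; lia. Qed.

(** The total is at most 3N in absolute value, which gives 3^d N^d; the three d-th powers add 3 N^d.
    Polynomial growth in [N] is what the divisor bound requires. *)
Lemma absz_discr_le (u : I * I * I) :
  (`|discr (@freq N) d u| <= (3 ^ d + 3) * N ^ d)%N.
Proof.
have leX (x : int) (m : nat) : `|x| <= m%:Z -> `|x ^+ d| <= (m ^ d)%N%:Z.
  by move=> xm; rewrite normrX -[leRHS]natz natrX natz lerXn2r ?nnegrE.
have psum_le (k : nat) (X : int) : (forall i : I, `|freq i ^+ k| <= X) ->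
    `|psum (@freq N) k u| <= X * 3.
  move=> leX'; rewrite /psum; have := leX' u.1.1; have := leX' u.1.2; have := leX' u.2.
  by move: (_ ^+ k) (_ ^+ k) (_ ^+ k) => x y z; lia.
rewrite -lez_nat abszE; apply: le_trans (ler_normB _ _) _.
rewrite mulnDl PoszD -expnMn; apply: lerD.
  by apply: leX; rewrite mulnC PoszM; apply: psum_le => i; exact: normz_freq.
by rewrite mulnC PoszM; apply: psum_le => i; apply: leX; exact: normz_freq.
Qed.

Lemma expsum_cube a (z : R * R) : expsum d N a z ^+ 3 =
  trigpoly (fun u : I * I * I => a (freq u.1.1) * a (freq u.1.2) * a (freq u.2))
    (psum (@freq N) 1) (psum (@freq N) d) z.
Proof.
rewrite exprSr expr2 /expsum big_distrlr/= pair_big/= big_distrlr/= pair_big/=.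
apply: eq_bigr => u _ /=; rewrite [X in X * _ = _]mulrACA -e2piD mulrACA -e2piD.
by congr (_ * e2pi _); rewrite /psum !expr1 !rmorphD/=; ring.
Qed.

Lemma l2norm_ge0 a : 0 <= l2norm N a.
Proof. exact: sqrtr_ge0. Qed.

(** The sixth power of the norm is the mean square of the cubed sum, hence at most ((2M)^2 + 9)
    times the sixth power of the l2 norm. *)
Lemma admissible6 (M : nat) (K : R) : (1 < d)%N -> odd d ->
  (forall u, discr (@freq N) d u != 0 ->
     size (divisors `|discr (@freq N) d u|) <= M)%N ->
  0 <= K -> ((2 * M) ^ 2 + 9)%:R <= K ^+ 6 -> admissible d (6%:R)%:E N K.
Proof.
move=> d_gt1 d_odd leM K_ge0 leK a.
pose b (i : I) := cmod (a (freq i)).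
have b_ge0 i : 0 <= b i by exact: cmod_ge0.
set S := \sum_i b i ^+ 2.
have S_ge0 : 0 <= S by apply: sumr_ge0 => i _; exact: sqr_ge0.
have l2E : l2norm N a ^+ 2 = S by rewrite sqr_sqrtr.
rewrite unlock.
under eq_integral do rewrite abse_EFin ger0_norm ?cmod_ge0// poweR_EFin powR_mulrn ?cmod_ge0//.
set J := (\int[_]_x _)%E.
have J_ge0 : (0 <= J)%E by apply: integral_ge0 => z _; rewrite lee_fin exprn_ge0// cmod_ge0.
have : (J <= ((K * l2norm N a) ^+ 6)%:E)%E.
  rewrite /J; under eq_integral do
    rewrite (_ : 6 = 3 * 2)%N// exprM -cmodX expsum_cube.
  apply: le_trans (integral_cmod_trigpoly_sqr _ _ _) _; rewrite lee_fin.
  under eq_bigr do under eq_bigr do rewrite !cmodM.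
  apply: le_trans (sum_resonant_le (@freq_inj) b_ge0 freq_rev d_gt1 d_odd leM) _.
  rewrite -/S exprMn (_ : 6 = 2 * 3)%N// [l2norm N a ^+ _]exprM l2E.
  by rewrite ler_wpM2r// exprn_ge0.
(* The bound just proved makes [J] finite, so sixth roots are taken among real numbers. *)
case: J J_ge0 => [r||]//; rewrite !lee_fin => r_ge0 le_r.
have Kl_ge0 : 0 <= K * l2norm N a by rewrite mulr_ge0// l2norm_ge0.
have : r `^ 6%:R^-1 <= ((K * l2norm N a) ^+ 6) `^ 6%:R^-1.
  by apply: ge0_ler_powR; rewrite ?nnegrE ?invr_ge0// exprn_ge0.
by rewrite -powR_mulrn// -powRrM mulfV// powRr1.
Qed.

End ExponentialSum.

Theorem theorem1p4 (R : realType) (d : nat) (d_ge3 : (3 <= d)%N)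
    (d_odd : odd d) (eps : R) (eps_gt0 : 0 < eps) :
  exists C : R, forall N : nat, (0 < N)%N ->
    (best_const d (6%:R)%:E N <= (C * N%:R `^ eps)%:E)%E.
Proof.
have d_gt1 : (1 < d)%N by exact: ltnW.
(* This [k] makes N^(d/k) <= N^(3 eps). *)
have [k k_gt0 dk] : exists2 k : nat, (0 < k)%N & d%:R <= 3 * eps * k%:R.
  exists (Num.truncn (d%:R / (3 * eps))).+1 => //.
  by rewrite mulrC -ler_pdivrMr ?mulr_gt0// ltW// truncnS_gt.
(* The constant of the divisor bound times that of the discriminant bound. *)
pose c : nat := ((k ^ k) ^ (2 ^ k) * (3 ^ d + 3))%N.
have c_ge1 : 1 <= c%:R :> R.
  by rewrite ler1n muln_gt0 !expn_gt0 k_gt0/= addn_gt0 orbT.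
exists (13 * c%:R) => N N_gt0; set X : R := N%:R `^ eps.
have X_ge1 : 1 <= X.
  suff : 1 `^ eps <= X by rewrite powR1.
  by apply: ge0_ler_powR; rewrite ?nnegrE ?ler1n// ltW.
pose M := \max_(u | discr (@freq N) d u != 0) size (divisors `|discr (@freq N) d u|).
have Mk : (M ^ k <= c * N ^ d)%N.
  rewrite /M; elim/big_ind : _ => [|m n ? ?|u Du0]; first by rewrite exp0n.
    by rewrite /maxn; case: ifP.
  apply: leq_trans (size_divisors_exp k_gt0 _) _; first by rewrite absz_gt0.
  by rewrite /c -mulnA leq_mul2l absz_discr_le orbT.
(* Take k-th roots in [Mk], using c <= c^k. The exponent 3 suffices because [M] enters squared
   against a sixth power. *)
have M_le : M%:R <= c%:R * X ^+ 3.
  have cX_ge0 : 0 <= c%:R * X ^+ 3 by rewrite mulr_ge0// exprn_ge0// powR_ge0.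
  rewrite -(ler_pXn2r k_gt0) ?nnegrE//.
  rewrite -natrX (le_trans (y := (c * N ^ d)%:R)) ?ler_nat//.
  rewrite natrM exprMn ler_pM ?ler_eXnr//.
  rewrite natrX -exprM -[X ^+ _]powR_mulrn ?powR_ge0// -powRrM.
  rewrite -powR_mulrn// ler_powR ?ler1n// natrM.
  by lra.
apply: ereal_inf_lbound; exists (13 * c%:R * X) => //.
apply: (@admissible6 R d N M) => //.
- by move=> u Du0; apply: (leq_bigmax_cond (F := fun u => size (divisors `|discr (@freq N) d u|))).
- by rewrite !mulr_ge0// (le_trans ler01).
(* As c and X are at least 1, (2M)^2 + 9 <= 4 c^2 X^6 + 9 <= 13 c^6 X^6 <= (13 c X)^6, whence the
   constant 13. *)
- have X6_ge1 : 1 <= X ^+ 6 by rewrite exprn_ege1.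
  have : (M%:R : R) ^+ 2 <= c%:R ^+ 2 * X ^+ 6.
    rewrite (_ : 6 = 3 * 2)%N// exprM -exprMn lerXn2r ?nnegrE//.
    exact: le_trans M_le.
  have c2_ge1 : 1 <= c%:R ^+ 2 :> R by rewrite exprn_ege1.
  have c24 : c%:R ^+ 2 <= c%:R ^+ 6 :> R by rewrite ler_weXn2l.
  rewrite natrD natrX natrM !exprMn.
  by nra.
Qed.
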